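(* For each pair of positive integers $m,d$, there are only finitely many totally real number fields $K$ of degree $d=[K:\mathbb{Q}]$ such that all elements of $m\mathcal{O}_K^+$ are sums of squares of elements of $\mathcal{O}_K$.
   Context: $\mathcal{O}_K$ is the ring of integers of $K$; number fields are considered inside a fixed algebraic closure of $\mathbb{Q}$. An element $\alpha\in K$ is totally positive if $\sigma(\alpha)>0$ for every embedding $\sigma:K\hookrightarrow\mathbb{R}$; $\mathcal{O}_K^+$ is the set of totally positive elements of $\mathcal{O}_K$, and $m\mathcal{O}_K^+=\{m\alpha:\alpha\in\mathcal{O}_K^+\}$. *)

(* Defs.v *)
From HB Require Import structures.
From mathcomp Require Import all_boot all_order all_algebra all_field.
From mathcomp Require Import complex.
From mathcomp Require Import classical_sets cardinality reals.

Set Implicit Arguments.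
Unset Strict Implicit.
Unset Printing Implicit Defensive.

Import Order.TTheory GRing.Theory Num.Theory.
Local Open Scope classical_set_scope.
Local Open Scope ring_scope.

(* A number field is a finite extension of Q, i.e. L : fieldExtType rat, of
   degree \dim {:L}.  Field embeddings are the ring morphisms out of L. *)

Definition totally_real (R : realType) (L : fieldExtType rat) : Prop :=
  forall sigma : {rmorphism L -> R[i]}, range sigma `<=` range (real_complex R).

Definition ring_of_integers (L : fieldExtType rat) : set L :=
  [set x | integralOver (intr : int -> L) x].
Arguments ring_of_integers : clear implicits.

Definition totally_positive (R : realType) (L : fieldExtType rat) (a : L) :
  Prop := forall sigma : {rmorphism L -> R}, 0 < sigma a.

Definition totally_positive_integers (R : realType) (L : fieldExtType rat) :
  set L := [set a | ring_of_integers L a /\ totally_positive R a].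
Arguments totally_positive_integers : clear implicits.

Definition sums_of_integral_squares (L : fieldExtType rat) : set L :=
  [set a | exists n (x : 'I_n -> L),
     (forall i, ring_of_integers L (x i)) /\ a = \sum_(i < n) x i ^+ 2].
Arguments sums_of_integral_squares : clear implicits.

(* algC is the fixed algebraic closure of Q: a number field inside it is the
   image of an embedding of some L, and two of them are equal when they are
   equal as subsets of algC (rather than merely isomorphic).  Total reality,
   total positivity and integrality are intrinsic to L, hence do not depend on
   the embedding iota chosen to present K. *)
Definition totally_real_fields_with_squares (R : realType) (m d : nat) :
  set (set algC) :=
  [set K | exists (L : fieldExtType rat) (iota : {rmorphism L -> algC}),
     [/\ K = range iota, \dim {:L} = d, totally_real R L &
         [set a *+ m | a in totally_positive_integers R L]
           `<=` sums_of_integral_squares L]].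

(* Main.v *)
Require Import Defs.
From HB Require Import structures.
From mathcomp Require Import all_boot all_order all_algebra all_field.
From mathcomp Require Import complex polyrcf ring zify.
From mathcomp Require Import classical_sets cardinality reals boolp.

(** Call the house of an algebraic integer the largest absolute value of its
    conjugates.  A totally real field K whose elements of [m O_K^+] are all
    sums of integral squares turns out to be generated by its integers of house
    less than C = 2m+2.

    Indeed let F be a subfield containing those small integers, let x in O_K
    have all its real conjugates in absolute value below N+1, and assume by
    induction that F contains every integer of house below N.  The integer
    a = x + (N+1) is totally positive with all conjugates below 2(N+1), so
    m a = sum y_i^2 for some y_i in O_K, and every conjugate of y_i has square
    less than 2m(N+1).  As soon as N >= 2m+2 this is at most N^2, so the
    y_i have house below N and lie in F; hence so do m a, a and x.  Thus F
    contains O_K ([house_descent]), and K itself since every element of K has a nonzero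
    integral multiple ([integral_multiple]).

    By the argument of Northcott, the integers of degree at most d and house
    below C all lie in one finite set T of algebraic numbers: the coefficients
    of their minimal polynomials are integers bounded in terms of C and d
    ([finite_small_poly_root], [house_lt_small_poly_root]).  So K is the
    smallest subfield containing a subset of T, namely the intersection of T
    and K, and there are finitely many subsets of T.

    The house is expressed through the embeddings of the field into R, so
    bounding the minimal polynomial of x requires every complex root of it to be
    the image of x under some embedding of the whole field; this is
    [conjugate_embedding], obtained by extending a morphism defined on Q(x) one
    generator at a time. *)

Set Implicit Arguments.
Unset Strict Implicit.
Unset Printing Implicit Defensive.

Import Order.TTheory GRing.Theory Num.Theory.
Local Open Scope classical_set_scope.
Local Open Scope ring_scope.

(** * Extension of field embeddings *)

(** The first isomorphism theorem in a form that avoids quotients: [v] presents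
    [A] as a subring of [B] covered by the image of [e], and the lift of [a] to
    [P] is picked by choice.  Here [P] will be a polynomial ring and [e] the
    evaluation at a generator. *)
Section FactorThroughSubring.
Variables (P : comNzRingType) (A B C : nzRingType).
Variables (e : {rmorphism P -> B}) (v : {rmorphism A -> B})
          (f : {rmorphism P -> C}).
Hypothesis v_im : forall a, exists p, e p == v a.
Hypothesis ker_le : forall p, e p = 0 -> f p = 0.

Let g a := f (xchoose (v_im a)).

Let gE p a : e p = v a -> g a = f p.
Proof.
move=> epa; apply/subr0_eq; rewrite -rmorphB ker_le // rmorphB epa.
by rewrite (eqP (xchooseP (v_im a))) subrr.
Qed.

Let gP a : e (xchoose (v_im a)) = v a.
Proof. exact: eqP (xchooseP (v_im a)). Qed.

Fact factor_zmod_morphism : zmod_morphism g.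
Proof.
by move=> a b; rewrite /g -rmorphB; apply: gE; rewrite !rmorphB !gP.
Qed.
Fact factor_monoid_morphism : monoid_morphism g.
Proof.
split=> [|a b]; first by rewrite -(rmorph1 f); apply: gE; rewrite !rmorph1.
by rewrite /g -rmorphM; apply: gE; rewrite !rmorphM !gP.
Qed.
HB.instance Definition _ :=
  GRing.isZmodMorphism.Build A C g factor_zmod_morphism.
HB.instance Definition _ :=
  GRing.isMonoidMorphism.Build A C g factor_monoid_morphism.

Lemma factor_rmorphism :
  exists h : {rmorphism A -> C}, forall p a, e p = v a -> h a = f p.
Proof. by exists (g : {rmorphism A -> C}). Qed.
End FactorThroughSubring.

Section Extension.
Variables (F : fieldType) (L : fieldExtType F) (C : closedFieldType).

(** A morphism on E and a point r define a morphism on E(x) sending x to r as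
    soon as r satisfies all the algebraic relations of x over E. *)
Lemma simple_extension_morphism (E : fieldType) (j : {rmorphism E -> L})
    (phi : {rmorphism E -> C}) (M : {subfield L}) (x : L) (r : C) :
    (forall y, y \in M -> exists p, y = (map_poly j p).[x]) ->
    (forall p, root (map_poly j p) x -> root (map_poly phi p) r) ->
  exists psi : {rmorphism subvs_of M -> C},
    forall p a, (map_poly j p).[x] = vsval a -> psi a = (map_poly phi p).[r].
Proof.
move=> genM xr.
apply: (@factor_rmorphism _ _ _ _ (horner_eval x \o map_poly j)
  (vsval : {rmorphism subvs_of M -> L}) (horner_eval r \o map_poly phi)).
  by move=> a; have [p yp] := genM _ (subvsP a); exists p; apply/eqP.
by move=> p /= /rootP/xr/rootP.
Qed.

(** As C is algebraically closed, a morphism defined on K but not on all of L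
    extends to K(z) for any z outside K, sending z to a root of the image of its
    minimal polynomial; induct on the codimension of K. *)
Lemma extend_morphism (K : {subfield L}) (phi : {rmorphism subvs_of K -> C}) :
  exists psi : {rmorphism L -> C}, forall a, psi (vsval a) = phi a.
Proof.
have [n] := ubnP (\dim {:L} - \dim K); elim: n => // n IHn in K phi *.
rewrite ltnS => lenK; have [fullK | ] := altP (K =P {:L}%AS).
  have [||h hP] := @factor_rmorphism _ _ _ _
     (vsval : {rmorphism subvs_of K -> L}) (idfun : {rmorphism L -> L}) phi.
  - by move=> a; exists (vsproj K a); apply/eqP/vsprojK; rewrite fullK memvf.
  - by move=> p vp0; rewrite (_ : p = 0) ?rmorph0 //; apply: val_inj.
  by exists h => a; apply: hP.
move=> notfull; have [z _ Kz] : exists2 z, z \in {:L}%VS & z \notin K.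
  by apply/subvPn; apply: contra notfull => fK; rewrite -val_eqE eqEsubv subvf.
have [p0 Dp0] := polyOver_subvs (minPolyOver K z).
have [r pr0] : exists r, root (map_poly phi p0) r.
  apply/closed_rootP; rewrite size_map_poly.
  rewrite -(size_map_poly (vsval : {rmorphism subvs_of K -> L})) -Dp0.
  by rewrite size_minPoly.
have [||psi1 psi1P] := @simple_extension_morphism _ vsval phi <<K; z>>%AS z r.
- move=> y /Fadjoin_polyP[_ /polyOver_subvs[q ->] ->].
  by exists q.
- move=> p pz0; have: minPoly K z %| map_poly vsval p.
    by apply: minPoly_dvdp => //; apply/polyOver_subvs; exists p.
  rewrite Dp0 dvdp_map => /dvdpP[q ->].
  by rewrite rmorphM rootM pr0 orbT.
have [|psi psiP] := IHn <<K; z>>%AS psi1.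
  apply: leq_trans lenK; rewrite ltn_sub2lE.
    rewrite (ltn_leqif (dimv_leqif_sup (subv_adjoin K z))).
    by apply: contra Kz => /subvP->; rewrite ?memv_adjoin.
  exact/dimvS/subvf.
exists psi => a.
have Ka : vsval a \in <<K; z>>%VS by rewrite (subvP (subv_adjoin K z)) ?subvsP.
rewrite -[vsval a](vsprojK Ka) psiP (psi1P a%:P) ?map_polyC ?hornerC //.
by rewrite vsprojK.
Qed.

End Extension.

(** The hypothesis on [p] holds when it is the minimal polynomial of [x]; it
    makes the roots of [p] admissible images of [x]. *)
Lemma conjugate_embedding (L : fieldExtType rat) (C : numClosedFieldType)
    (x : L) (p : {poly rat}) (r : C) :
    (forall q, root (map_poly (in_alg L) q) x -> p %| q) ->
    root (map_poly ratr p) r ->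
  exists psi : {rmorphism L -> C}, psi x = r.
Proof.
move=> p_min pr0.
have [||psi1 psi1P] :=
  @simple_extension_morphism _ L C _ (in_alg L) ratr <<1; x>>%AS x r.
- by move=> y /Fadjoin1_polyP[q ->]; exists q.
- by move=> q /p_min/dvdpP[q' ->]; rewrite rmorphM rootM pr0 orbT.
have [psi psiP] := extend_morphism psi1.
exists psi; rewrite -[x](vsprojK (memv_adjoin 1 x)) psiP (psi1P 'X).
  by rewrite map_polyX hornerX.
by rewrite map_polyX hornerX vsprojK ?memv_adjoin.
Qed.

(** * Finitely many algebraic numbers with bounded minimal polynomial *)

(** Multiplying by [X - r] turns a coefficient c_i into c_(i-1) - r c_i, which
    at most multiplies the bound by 1 + b. *)
Lemma coef_prod_XsubC_le (C : numDomainType) (b : C) (rs : seq C) (i : nat) :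
  0 <= b -> all (fun r => `|r| <= b) rs ->
  `|(\prod_(r <- rs) ('X - r%:P))`_i| <= (1 + b) ^+ size rs.
Proof.
move=> b0; elim: rs i => [|r rs IH] i /=.
  by move=> _; rewrite big_nil coef1; case: (i == 0)%N; rewrite ?normr1 ?normr0.
case/andP=> rb /IH{}IH.
rewrite big_cons mulrBl coefB coefXM coefCM.
rewrite (le_trans (ler_normB _ _))// exprS mulrDl mul1r lerD //.
  by case: (i == 0)%N => //; rewrite normr0 exprn_ge0 ?addr_ge0.
by rewrite normrM ler_pM.
Qed.

Local Notation pZtoC := (map_poly (intr : int -> algC)).

Definition small_poly_root (d M : nat) : set algC :=
  [set z | exists p : {poly int}, [/\ p != 0, (size p <= d.+1)%N,
     forall i, (absz (p`_i)%R <= M)%N & root (pZtoC p) z]].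

Lemma finite_poly_roots (F : closedFieldType) (p : {poly F}) :
  p != 0 -> finite_set [set z | root p z].
Proof.
move=> p0; have [rs ->] := closed_field_poly_normal p.
apply: sub_finite_set (finite_seq rs) => z /=.
by rewrite rootZ ?lead_coef_eq0// root_prod_XsubC.
Qed.

(** Shifting by M encodes the polynomials at hand as functions between finite
    sets; each nonzero one has finitely many roots. *)
Lemma finite_small_poly_root d M : finite_set (small_poly_root d M).
Proof.
pose code := {ffun 'I_d.+1 -> 'I_(2 * M).+1}.
pose decode (f : code) : {poly int} :=
  \poly_(i < d.+1) ((f (inord i))%:Z - M%:Z).
pose roots (f : code) := [set z | decode f != 0 /\ root (pZtoC (decode f)) z].
apply: (@sub_finite_set _ _ (\bigcup_(f in [set: code]) roots f)); last first.
  apply: bigcup_finite; first exact: finite_finset.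
  move=> f _; have [df0 | f0] := eqVneq (decode f) 0.
    by apply: sub_finite_set (finite_set0 _) => z []; rewrite df0 eqxx.
  apply: (@sub_finite_set _ _ [set z | root (pZtoC (decode f)) z]).
    by move=> z /= [].
  apply: finite_poly_roots.
  by rewrite map_poly_eq0_id0 ?intr_eq0 ?lead_coef_eq0.
move=> z [p [p0 szp pM pz]].
pose f : code := [ffun i : 'I_d.+1 => inord (absz (p`_i + M%:Z))].
exists f => //; suff dp : decode f = p by rewrite /roots /= dp.
apply/polyP=> i; rewrite coef_poly; case: ltnP => [ltid|leid].
  by rewrite ffunE inordK// inordK; have := pM i; lia.
by rewrite nth_default ?(leq_trans szp).
Qed.

Lemma finite_subsets (T : choiceType) (A : set T) :
  finite_set A -> finite_set [set B | B `<=` A].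
Proof.
move=> /finite_seqP[s ->].
pose sub (m : (size s).-tuple bool) := [set` mask m s].
apply: (@sub_finite_set _ _ (sub @` setT)); last first.
  exact/finite_image/finite_finset.
move=> B sBs; exists (map_tuple (fun x => `[< B x >]) (in_tuple s)) => //.
rewrite /sub /= -filter_mask; apply/seteqP; split=> x /=; rewrite mem_filter.
  by case/andP=> /asboolP.
by move=> Bx; rewrite (sBs x Bx) andbT; apply/asboolP.
Qed.

(** * Integral multiples *)

Lemma map_poly_ratr (L : fieldExtType rat) (F : fieldType)
    (sigma : {rmorphism L -> F}) (q : {poly rat}) :
  map_poly ratr q = map_poly sigma (map_poly (in_alg L) q).
Proof.
have ratrE a : ratr a = sigma (in_alg L a).
  by rewrite -(fmorph_eq_rat (sigma \o in_alg L)).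
by rewrite -(map_poly_comp sigma); apply: eq_map_poly => a; apply: ratrE.
Qed.

Lemma map_poly_intr (A B : nzRingType) (f : {rmorphism A -> B})
    (p : {poly int}) :
  map_poly intr p = map_poly f (map_poly intr p).
Proof.
rewrite -(map_poly_comp f); apply: eq_map_poly => a.
by rewrite -(rmorph_int f).
Qed.

Lemma intrL_eq0 (L : fieldExtType rat) (k : int) : (k%:~R == 0 :> L) = (k == 0).
Proof. by rewrite -(rmorph_int (in_alg L)) fmorph_eq0 intr_eq0. Qed.

(** If c is the leading coefficient of an integer polynomial p of degree n that
    kills y, then c y is a root of the monic integer polynomial
    c^(n-1) p(X / c). *)
Lemma integral_multiple (L : fieldExtType rat) (y : L) :
  exists2 c : int, c != 0 & ring_of_integers L (y *~ c).
Proof.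
have /polyOver1P[q Dq] := minPolyOver 1 y.
have [p [a a0 Dp]] := rat_poly_scale q.
have q0 : q != 0.
  by rewrite -(map_poly_eq0 (in_alg L)) -Dq monic_neq0 ?monic_minPoly.
have p0 : p != 0 by apply: contraNneq q0 => p0; rewrite Dp p0 rmorph0 scaler0.
have py : (map_poly (intr : int -> L) p).[y] = 0.
  have := minPolyxx 1 y; rewrite Dq Dp linearZ hornerZ /= => /eqP.
  rewrite -map_poly_intr mulf_eq0 scaler_eq0 oner_eq0 orbF invr_eq0 intr_eq0.
  by rewrite (negPf a0) => /eqP.
have [n szp] : exists n, size p = n.+2.
  case sz : (size p) => [|[|n]]; last by exists n.
    by move/eqP: sz; rewrite size_poly_eq0 (negPf p0).
  have /size_poly1P[b b0 pb] : size p == 1%N by rewrite sz.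
  move: py; rewrite pb map_polyC hornerC => /eqP.
  by rewrite intrL_eq0 (negPf b0).
set c := lead_coef p; exists c; first by rewrite lead_coef_eq0.
pose P := 'X^(n.+1) + \poly_(i < n.+1) (p`_i * c ^+ (n - i)) : {poly int}.
exists P.
  by rewrite monicE lead_coefDl ?size_polyXn ?ltnS ?size_poly // lead_coefXn.
apply/rootP; rewrite rmorphD /= map_polyXn hornerD hornerXn.
rewrite -mulrzr exprMn.
have := congr1 ( *%R (c%:~R ^+ n)) py; rewrite mulr0 => <-.
rewrite [in RHS]horner_coef size_map_poly_id0 ?intrL_eq0 ?lead_coef_eq0 // szp.
rewrite big_ord_recr /= mulrDr addrC; congr (_ + _).
  have -> : map_poly intr (\poly_(i < n.+1) (p`_i * c ^+ (n - i)))
      = \poly_(i < n.+1) (p`_i * c ^+ (n - i))%:~R :> {poly L}.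
    by apply/polyP=> i; rewrite coef_map !coef_poly; case: ifP.
  rewrite horner_poly mulr_sumr; apply: eq_bigr => i _.
  rewrite coef_map /= exprMn rmorphM rmorphXn /=.
  have -> : (c%:~R ^+ n : L) = c%:~R ^+ (n - i) * c%:~R ^+ i.
    by rewrite -exprD subnK // -ltnS.
  by ring.
have -> : (map_poly intr p)`_n.+1 = c%:~R :> L.
  by rewrite coef_map /c lead_coefE szp.
by rewrite mulrA -exprSr mulrC.
Qed.

(** * Integers of bounded house *)

Section House.
Variables (R : realType) (L : fieldExtType rat).

(** Only the real embeddings are consulted, so this bounds the house of [x] when
    L is totally real. *)
Definition house_lt (N : nat) (x : L) : Prop :=
  forall sigma : {rmorphism L -> R}, `|sigma x| < N%:R.

(** The images of [x] in R are all roots of the same nonzero polynomial. *)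
Lemma house_lt_exists x : exists N, house_lt N x.
Proof.
have [q q0 qx] : algebraicOver (in_alg L) x.
  have /polyOver1P[q Dq] := minPolyOver 1 x.
  exists q; last by rewrite -Dq root_minPoly.
  by rewrite -(map_poly_eq0 (in_alg L)) -Dq monic_neq0 ?monic_minPoly.
pose B : R := cauchy_bound (map_poly ratr q).
exists (Num.bound B) => sigma.
apply: lt_trans (archi_boundP (cauchy_bound_ge0 _)).
apply: cauchy_boundP; first by rewrite map_poly_eq0.
by rewrite (map_poly_ratr sigma) /= horner_map (rootP qx) rmorph0.
Qed.

Section RealPart.
Variable sigma : {rmorphism L -> R[i]}.
Hypothesis sigma_real : range sigma `<=` range (real_complex R).

Let tau x := complex.Re (sigma x).

Let tauE x : sigma x = real_complex R (tau x).
Proof. by have [t _ tx] := sigma_real (imageT sigma x); rewrite /tau -tx. Qed.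

Let tau_unique x t : sigma x = real_complex R t -> tau x = t.
Proof. by rewrite /tau => ->. Qed.

Fact real_part_zmod_morphism : zmod_morphism tau.
Proof. by move=> x y; apply: tau_unique; rewrite rmorphB !tauE rmorphB. Qed.

Fact real_part_monoid_morphism : monoid_morphism tau.
Proof.
split=> [|x y]; apply: tau_unique; first by rewrite !rmorph1.
by rewrite rmorphM !tauE rmorphM.
Qed.
HB.instance Definition _ :=
  GRing.isZmodMorphism.Build L R tau real_part_zmod_morphism.
HB.instance Definition _ :=
  GRing.isMonoidMorphism.Build L R tau real_part_monoid_morphism.

Lemma real_embedding :
  exists t : {rmorphism L -> R}, forall x, sigma x = real_complex R (t x).
Proof. by exists (tau : {rmorphism L -> R}); apply: tauE. Qed.
End RealPart.

Hypothesis L_real : totally_real R L.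

(** The roots of the minimal polynomial of [x] in R[i] are the images of [x]
    under embeddings of L, which are real, so the house bounds all of them and
    thereby the coefficients.  The bound N+1 is the 1 + b of
    [coef_prod_XsubC_le]. *)
Lemma house_lt_small_poly_root (iota : {rmorphism L -> algC})
    (N : nat) (x : L) :
  ring_of_integers L x -> house_lt N x ->
  small_poly_root (\dim {:L}) (N.+1 ^ \dim {:L}) (iota x).
Proof.
move=> [p0 mon_p0 p0x] xN.
have Ax : iota x \in Aint.
  apply: (@root_monic_Aint (pZtoC p0)).
  - by rewrite (map_poly_intr iota) fmorph_root.
  - by rewrite monic_map.
  - by apply/polyOverP=> i; rewrite coef_map rpred_int.
have [q [Dq mon_q] q_min] := minCpolyP (iota x).
have /floorpP[p Dp] : minCpoly (iota x) \is a polyOver Num.int := Ax.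
have Dqp : q = map_poly intr p.
  apply: (map_poly_inj (ratr : {rmorphism rat -> algC})).
  by rewrite -map_poly_intr -Dq.
have mon_p : p \is monic.
  have /monicP := mon_q; rewrite Dqp lead_coef_map_inj //; last exact: intr_inj.
  by move=> lp1; apply/monicP/(@intr_inj rat).
have szq : size q = size p.
  by rewrite Dqp size_map_poly_id0 // (monicP mon_p) oner_eq0.
have szd : (size p <= (\dim {:L}).+1)%N.
  have /polyOver1P[g Dg] := minPolyOver 1 x.
  have : q %| g.
    by rewrite -q_min (map_poly_ratr iota) -Dg fmorph_root root_minPoly.
  move=> /dvdp_leq; rewrite szq -(size_map_poly (in_alg L)) -Dg size_minPoly.
  rewrite -(map_poly_eq0 (in_alg L)) -Dg monic_neq0 ?monic_minPoly //.
  move=> /(_ isT)/leq_trans; apply.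
  by rewrite ltnS adjoin_degreeE dimv1 divn1; apply/dimvS/subvf.
have q_min' g : root (map_poly (in_alg L) g) x -> q %| g.
  by move=> gx; rewrite -q_min (map_poly_ratr iota) fmorph_root.
exists p; split=> //; first exact: monic_neq0.
  move=> i.
  have [rs] := closed_field_poly_normal (map_poly (intr : int -> R[i]) p).
  rewrite (monicP (monic_map _ mon_p)) scale1r => Drs.
  have rsN : all (fun r : R[i] => `|r| <= N%:R) rs.
    apply/allP=> r; rewrite -root_prod_XsubC -Drs => pr0.
    have [|psi psix] := @conjugate_embedding L R[i] x q r q_min'.
      rewrite Dqp -map_poly_comp; congr (root _ _): pr0.
      by apply: eq_map_poly => a /=; rewrite rmorph_int.
    have [t Dt] := real_embedding (@L_real psi).
    rewrite -psix Dt -(rmorph_nat (real_complex R)) normc_def /=.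
    by rewrite lecR expr0n addr0 sqrtr_sqr ltW.
  have := coef_prod_XsubC_le i (ler0n _ N) rsN; rewrite -Drs coef_map /=.
  have szrs : (size rs <= \dim {:L})%N.
    rewrite -ltnS -(size_prod_XsubC rs id) -Drs.
    by rewrite size_map_poly_id0 ?(monicP mon_p) ?oner_eq0.
  rewrite -intr_norm -abszE -pmulrn -[1]/(1%:R) -natrD -natrX ler_nat.
  by move/leq_trans; apply; rewrite add1n leq_pexp2l.
by rewrite -Dp root_minCpoly.
Qed.

(** Under a real embedding each square is at most the whole sum. *)
Lemma house_lt_sum_squares (N b n : nat) (a : L) (x : 'I_n -> L) :
  a = \sum_(i < n) x i ^+ 2 -> (b <= N ^ 2)%N ->
  (forall sigma : {rmorphism L -> R}, sigma a < b%:R) ->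
  forall i, house_lt N (x i).
Proof.
move=> Da bN ab i sigma.
rewrite -(ltr_pXn2r (n := 2)) ?nnegrE ?ler0n // real_normK ?num_real //.
apply: le_lt_trans (_ : _ <= sigma a) (lt_le_trans (ab sigma) _).
  rewrite Da rmorph_sum (bigD1 i) //= rmorphXn lerDl sumr_ge0 // => j _.
  by rewrite rmorphXn sqr_ge0.
by rewrite -natrX ler_nat.
Qed.

Lemma house_ltW M N x : (M <= N)%N -> house_lt M x -> house_lt N x.
Proof. by move=> MN xM sigma; rewrite (lt_le_trans (xM sigma)) ?ler_nat. Qed.

End House.

(** * Subfields *)

Definition is_subfield (F : fieldType) (K : set F) : Prop :=
  [/\ K 1, forall x y, K x -> K y -> K (x - y),
      forall x y, K x -> K y -> K (x * y) & forall x, K x -> K x^-1].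

Section Subfield.
Variables (F : fieldType) (K : set F).
Hypothesis subK : is_subfield K.

Lemma subfield0 : K 0.
Proof. by case: (subK) => K1 KB _ _; rewrite -(subrr 1); apply: KB. Qed.

Lemma subfieldD x y : K x -> K y -> K (x + y).
Proof.
case: (subK) => _ KB _ _ Kx Ky; rewrite -[y]opprK -[- y]sub0r.
apply: (KB) => //; apply: (KB) => //; exact: subfield0.
Qed.

Lemma subfield_nat n : K n%:R.
Proof.
elim: n => [|n IHn]; first exact: subfield0.
by rewrite -natr1; apply: subfieldD => //; case: (subK).
Qed.

Lemma subfield_int k : K k%:~R.
Proof.
case: (subK) => _ KB _ _; case: k => n; first exact: subfield_nat.
by rewrite NegzE mulrNz -sub0r; apply: KB;
  [apply: subfield0 | apply: subfield_nat].
Qed.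

Lemma subfield_sum (I : Type) (r : seq I) (f : I -> F) :
  (forall i, K (f i)) -> K (\sum_(i <- r) f i).
Proof.
by move=> Kf; apply: big_ind => //; [apply: subfield0 | apply: subfieldD].
Qed.

Lemma subfield_cancel a x : a != 0 -> K a -> K (x * a) -> K x.
Proof.
case: (subK) => _ _ KM KV a0 Ka Kxa; rewrite -(mulfK a0 x).
by apply: KM => //; apply: KV.
Qed.
End Subfield.

Lemma is_subfield_smallest (F : fieldType) (S : set F) :
  is_subfield (smallest (@is_subfield F) S).
Proof.
split=> [K [[]//]|x y Sx Sy K SK|x y Sx Sy K SK|x Sx K SK].
all: case: (SK) => -[K1 KB KM KV] _.
- by apply: KB; [apply: Sx | apply: Sy].
- by apply: KM; [apply: Sx | apply: Sy].
- by apply: KV; apply: Sx.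
Qed.

Lemma is_subfield_range (F E : fieldType) (f : {rmorphism F -> E}) :
  is_subfield (range f).
Proof.
split=> [|_ _ [x _ <-] [y _ <-]|_ _ [x _ <-] [y _ <-]|_ [x _ <-]].
- by exists 1; rewrite ?rmorph1.
- by exists (x - y); rewrite ?rmorphB.
- by exists (x * y); rewrite ?rmorphM.
- by exists x^-1; rewrite ?fmorphV.
Qed.


(** * Generation by integers of small house *)

Section Descent.
Variables (R : realType) (m : nat) (L : fieldExtType rat)
  (iota : {rmorphism L -> algC}) (K : set algC).
Hypothesis m_gt0 : (0 < m)%N.
Hypothesis squares :
  [set a *+ m | a in totally_positive_integers R L]
    `<=` sums_of_integral_squares L.
Hypothesis subK : is_subfield K.
Hypothesis small_in_K : forall x, ring_of_integers L x ->
  house_lt R (2 * m + 2) x -> K (iota x).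

(** Writing x + (N+1) as m^-1 times a sum of squares replaces x by integers
    whose house is about the square root of 2m(N+1). *)
Lemma house_descent N x : ring_of_integers L x -> house_lt R N x -> K (iota x).
Proof.
elim: N => [|N IHN] in x *.
  by move=> xI /(house_ltW (leq0n (2 * m + 2))); apply: small_in_K xI.
have [leN | ltN] := leqP N.+1 (2 * m + 2).
  by move=> xI /(house_ltW leN); apply: small_in_K xI.
move=> xI xN; pose a := x + N.+1%:R.
have aI : ring_of_integers L a.
  by apply: integral_add => //; apply: integral_nat.
have a_pos : totally_positive R a.
  move=> sigma; rewrite rmorphD rmorph_nat -ltrBlDr sub0r.
  by have := xN sigma; rewrite ltr_norml => /andP[].
have [n [y [yI Da]]] : sums_of_integral_squares L (a *+ m).
  by apply: squares; exists a.
have Ky i : K (iota (y i)).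
  apply: IHN => //.
  apply: (house_lt_sum_squares (b := (2 * N.+1 * m)%N)) Da _ _ i.
    (* The threshold 2m+2 is chosen so that N >= 2m+2 gives 2m(N+1) <= N^2. *)
    nia.
  move=> sigma; rewrite rmorphMn natrM -mulr_natr ltr_pM2r ?ltr0n //.
  rewrite rmorphD rmorph_nat mul2n -addnn natrD ltrD2r.
  by have := xN sigma; rewrite ltr_norml => /andP[].
have Kma : K (iota a * m%:R).
  rewrite -[m%:R](rmorph_nat iota) -rmorphM mulr_natr Da rmorph_sum.
  apply: subfield_sum => // i; rewrite rmorphXn expr2.
  by case: (subK) => _ _ KM _; apply: KM.
have Ka : K (iota a).
  apply: (subfield_cancel subK _ _ Kma); last exact: subfield_nat.
  by rewrite pnatr_eq0 -lt0n.
have -> : iota x = iota a - N.+1%:R by rewrite rmorphD rmorph_nat addrK.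
by case: (subK) => _ KB _ _; apply: KB => //; apply: subfield_nat.
Qed.

Lemma house_generation y : K (iota y).
Proof.
have [c c0 cyI] := integral_multiple y.
have [N cyN] := house_lt_exists R (y *~ c).
have := house_descent cyI cyN; rewrite -mulrzr rmorphM rmorph_int.
by apply: subfield_cancel => //; [rewrite intr_eq0 | apply: subfield_int].
Qed.

End Descent.

(** * Finiteness *)

Theorem corollary8 (R : realType) (m d : nat) (hm : (0 < m)%N) (hd : (0 < d)%N) :
  finite_set (totally_real_fields_with_squares R m d).
Proof.
pose T := small_poly_root d ((2 * m + 2).+1 ^ d).
pose gen := smallest (@is_subfield algC).
apply: (@sub_finite_set _ _ (gen @` [set S | S `<=` T])); last first.
  exact/finite_image/finite_subsets/finite_small_poly_root.
move=> K [L [iota [DK dimL L_real squares]]].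
exists (T `&` K); first by move=> z [].
apply/seteqP; split.
  by apply: smallest_sub => [|z []//]; rewrite DK; apply: is_subfield_range.
move=> z; rewrite {1}DK => -[y _ <-].
apply: (house_generation hm squares (is_subfield_smallest _)) => x xI xC.
apply: sub_gen_smallest; split; last by rewrite DK; exists x.
by rewrite /T -dimL; apply: house_lt_small_poly_root xI xC.
Qed.
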